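(* Let $(S,\preceq)$ be a standard discrete poset whose covering graph is a rooted tree without leaves. Let $\boldsymbol{X}=(X_1,X_2,\ldots)$ be an IID sequence in $S$ whose common distribution has constant rate $\alpha$, let $\boldsymbol{Y}=(Y_1,Y_2,\ldots)$ be the corresponding sequence of ladder variables, and let $p\in(0,1)$. Consider the thinned point process associated with $\boldsymbol{Y}$, where each point is accepted with probability $p$ and rejected with probability $1-p$, independently from point to point (and independently of $\boldsymbol{Y}$). Then the distribution of the first accepted point has constant rate $p\alpha/(1-\alpha+p\alpha)$.
   Context: A standard discrete poset is a countable poset $(S,\preceq)$ such that $\{t\in S: t\preceq x\}$ is finite for each $x\in S$ (with the discrete topology and counting measure as reference measure). Its covering graph has vertex set $S$ and a directed edge $(x,y)$ whenever $y$ covers $x$ (i.e. $y$ is a minimal element of $\{t: t\succ x\}$). When this graph is a rooted tree, the root $e$ is the minimum element of $S$; a leaf is a vertex covered by no element. Distributions on $S$ have support $S$ (positive probability at every point). A random variable $X$ has upper probability function $F(x)=\mathbb{P}(X\succeq x)$, and has constant rate $\alpha>0$ if $\mathbb{P}(X=x)=\alpha F(x)$ for all $x\in S$. Ladder variables: $N_1=1$, $Y_1=X_1$, and recursively $N_{n+1}=\min\{k>N_n: X_k\succeq Y_n\}$, $Y_{n+1}=X_{N_{n+1}}$. The first accepted point is $Y_M$, with $M$ independent of $\boldsymbol{Y}$ and geometric on $\{1,2,\ldots\}$ with parameter $p$. *)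

(* Defs.v *)
From HB Require Import structures.
From mathcomp Require Import all_boot all_order all_algebra.
From mathcomp Require Import all_classical all_reals all_analysis.

Set Implicit Arguments.
Unset Strict Implicit.
Unset Printing Implicit Defensive.

Import Order.TTheory GRing.Theory Num.Theory.

Local Open Scope classical_set_scope.

Section standard_discrete_posets.
Context {disp : Order.disp_t} (S : porderType disp).

Definition standard_discrete_poset : Prop :=
  countable [set: S] /\ forall x : S, finite_set [set t : S | (t <= x)%O].

Definition minimal_in (A : set S) (y : S) : Prop :=
  A y /\ forall t, A t -> (t <= y)%O -> t = y.

(* [covering_graph x y] holds when [y] covers [x]. *)
Definition covering_graph : rel S :=
  fun x y => `[< minimal_in [set t | (x < t)%O] y >].

Definition leaf (x : S) : Prop := forall y, ~~ covering_graph x y.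

End standard_discrete_posets.

(* A directed graph is a rooted tree, with edges pointing away from the root,
   when some vertex [e] (the root) is joined to every vertex by exactly one
   directed path; [s] lists the vertices of the path after [e]. The root of a
   covering graph is then necessarily the minimum of the poset. *)
Definition rooted_tree (V : Type) (E : rel V) : Prop :=
  exists e : V, forall x : V, exists! s : seq V, path E e s /\ last e s = x.

(* Least index satisfying [Q], or the junk value [k0] if there is none. *)
Definition first_index (Q : pred nat) (k0 : nat) : nat :=
  if pselect (exists k, Q k) is left exQ then ex_minn exQ else k0.

(* Sequences are numbered from 0: [x n], [ladder_time x n], [ladder x n] stand
   for x_{n+1}, N_{n+1} - 1 and Y_{n+1}. The junk value is used when no later
   point dominates the current ladder point, which has probability zero for an
   IID sequence whose distribution has full support. *)
Section ladder_variables.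
Context {disp : Order.disp_t} {S : porderType disp}.

Fixpoint ladder_time (x : nat -> S) (n : nat) : nat :=
  if n is m.+1 then
    let N := ladder_time x m in
    first_index (fun k => (N < k)%N && (x N <= x k)%O) N
  else 0%N.

Definition ladder (x : nat -> S) (n : nat) : S := x (ladder_time x n).

(* [b n] tells whether the point [y n] is accepted; the junk index 0 is used
   when no point is accepted. *)
Definition first_accepted (b : nat -> bool) (y : nat -> S) : S :=
  y (first_index b 0).

End ladder_variables.

Section probability_notions.
Context {d : measure_display} {T : measurableType d} {R : realType}.
Variable P : probability T R.
Local Open Scope ereal_scope.

(* Measurability with respect to the power set of [U]. *)
Definition discrete_rv (U : Type) (Z : T -> U) : Prop :=
  forall A : set U, measurable (Z @^-1` A).

Definition mutually_independent (U : Type) (Z : nat -> T -> U) : Prop :=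
  forall (I : seq nat) (A : nat -> set U), uniq I ->
    P (\bigcap_(i in [set` I]) (Z i @^-1` A i)) =
    \prod_(i <- I) P (Z i @^-1` A i).

Definition identically_distributed (U : Type) (Z : nat -> T -> U) : Prop :=
  forall (n : nat) (A : set U), P (Z n @^-1` A) = P (Z 0%N @^-1` A).

Definition iid (U : Type) (Z : nat -> T -> U) : Prop :=
  [/\ forall n, discrete_rv (Z n), mutually_independent Z
    & identically_distributed Z].

Definition process_sigma_algebra (U : Type) (Z : nat -> T -> U) :
    set (set T) :=
  <<s [set E | exists n (A : set U), E = Z n @^-1` A] >>.

Definition independent_processes (U V : Type)
    (Z : nat -> T -> U) (W : nat -> T -> V) : Prop :=
  forall E F : set T, process_sigma_algebra Z E -> process_sigma_algebra W F ->
    P (E `&` F) = P E * P F.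

Context {disp : Order.disp_t} {S : porderType disp}.

Definition upper_probability (Z : T -> S) (x : S) : \bar R :=
  P [set w | (x <= Z w)%O].

(* The second clause is the convention that distributions on [S] have
   support [S]. *)
Definition has_constant_rate (Z : T -> S) (alpha : R) : Prop :=
  [/\ discrete_rv Z,
      forall x : S, 0 < P (Z @^-1` [set x]),
      (0 < alpha)%R
    & forall x : S, P (Z @^-1` [set x]) = alpha%:E * upper_probability Z x].

End probability_notions.

(* Main.v *)
Require Import Defs.
From HB Require Import structures.
From mathcomp Require Import all_boot all_order all_algebra.
From mathcomp Require Import all_classical all_reals all_analysis.
From mathcomp Require Import ring.

Set Implicit Arguments.
Unset Strict Implicit.
Unset Printing Implicit Defensive.

Import Order.TTheory GRing.Theory Num.Theory.
Import numFieldNormedType.Exports.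

Local Open Scope classical_set_scope.
Local Open Scope ring_scope.

(** Let [f] and [F] be the probability function and the upper probability
    function of the points, so that [f = alpha F], let [Z] be the first accepted
    point, let [g] be its probability function, and put
    [q = 1 - alpha + p alpha] and [r = p alpha / q].

    After a ladder point [t], the next one is the first later observation that
    dominates [t]. It is [x >= t] with probability [f x / F t], whatever happened
    before: the ladder points form a Markov chain ([ladder_transition]). The index
    of the first accepted point has the geometric law [p (1 - p)^n] and is
    independent of this chain, so splitting according to that index and to the
    previous ladder point gives the renewal equation ([first_accepted_rec])

      [g x = p f x + (1 - p) \sum_(t <= x) f x / F t * g t].

    In a tree the elements below [x] form a chain with exactly one element at each
    depth up to that of [x] ([tree_level_ancestors]). The equation is therefore a
    recursion on the depth, whose solution is [g x = p / q^(depth x + 1) f x]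
    ([first_accepted_pmf]).

    It remains to sum [g] over the elements above [x], depth by depth. The events
    [y <= X_0], for [y] above [x] at a given relative depth [j], are disjoint and
    cover the event that [X_0] lies above [x] at relative depth at least [j].
    Since [f = alpha F], a proportion [alpha] of the mass that reaches a level stays
    there, and level [j] carries the mass [alpha (1 - alpha)^j F x]
    ([rate_level]). As [g] is proportional to [f] on each level, [Z] gives it the mass
    [g x (1 - r)^j] ([first_accepted_level]). The geometric series has the sum [g x / r],
    which is the assertion that [Z] has constant rate [r].

    Sums over countable sets are handled by one principle: if each cell of a countable
    disjoint family has [c] times the probability of the corresponding cell of another
    such family, so have the unions ([proportional_bigcup]). *)

(** * Ancestors in a tree order *)

Lemma count_lt (T : eqType) (a b : pred T) (c : T) (s : seq T) :
  subpred a b -> c \in s -> ~~ a c -> b c -> (count a s < count b s)%N.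
Proof.
move=> ab cs nac bc; have /permP countE := perm_to_rem cs.
by rewrite (countE a) (countE b) /= (negbTE nac) bc ltnS sub_count.
Qed.

Section levels.
Context {disp : Order.disp_t} (S : porderType disp).

Lemma covering_path_le (x : S) s :
  path (@covering_graph _ S) x s -> (x <= last x s)%O.
Proof.
elim: s x => [//|y s IH] x /= /andP[/asboolP[xy _] /IH].
exact/le_trans/ltW.
Qed.

(** Local finiteness makes every interval finite. If [y] does not cover [x], some [t]
    lies strictly between them, and both [[x, t]] and [[t, y]] have fewer elements
    than [[x, y]]; concatenating saturated chains gives the induction. *)
Lemma covering_path_exists : standard_discrete_poset S ->
  forall x y : S, (x <= y)%O ->
  exists s, path (@covering_graph _ S) x s /\ last x s = y.
Proof.
move=> [_ fin] x0 y0; have /finite_seqP[u uE] := fin y0.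
have in_u t : (t <= y0)%O -> t \in u.
  by move=> ty; have : [set` u] t by rewrite -uE.
pose itv x y := count (fun t => (x <= t <= y)%O) u.
suff H n : forall x y, (itv x y < n)%N -> (y <= y0)%O -> (x <= y)%O ->
    exists s, path (@covering_graph _ S) x s /\ last x s = y.
  by apply: (H (itv x0 y0).+1).
elim: n => [//|n IH] x y xyn yy0; rewrite le_eqVlt => /predU1P[<-|xy].
  by exists [::].
have shrink a b c : (c <= y)%O -> (x <= a)%O -> (b <= y)%O -> (x <= c)%O ->
    ~~ (a <= c <= b)%O -> (itv a b < n)%N.
  move=> cy xa by_ xc cab; rewrite -ltnS; apply: leq_trans xyn; rewrite ltnS.
  apply: (count_lt (c := c)) => //; last by rewrite xc cy.
    by move=> t /andP[at_ tb]; rewrite (le_trans xa at_) (le_trans tb by_).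
  by apply: in_u; exact: le_trans yy0.
have [cov|ncov] := boolP (covering_graph x y).
  by exists [:: y]; rewrite /= cov.
have [t [xt ty tny]] : exists t, [/\ (x < t)%O, (t <= y)%O & t <> y].
  apply: contrapT => H; move/negP: ncov; apply; apply/asboolP; split => //= t xt ty.
  by apply: contrapT => tny; apply: H; exists t.
have ty' : (t < y)%O by rewrite lt_neqAle ty andbT; exact/eqP.
have [s1 [p1 l1]] : exists s, path (@covering_graph _ S) x s /\ last x s = t.
  apply: IH; last exact: ltW; last exact: le_trans yy0.
  by apply: (shrink _ _ y) => //; [exact: ltW | rewrite (lt_geF ty') andbF].
have [s2 [p2 l2]] : exists s, path (@covering_graph _ S) t s /\ last t s = y.
  apply: IH => //.
  by apply: (shrink _ _ x) => //; [exact: ltW|exact: ltW|rewrite (lt_geF xt)].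
by exists (s1 ++ s2); rewrite cat_path last_cat p1 l1.
Qed.

(** [anc x j] is the ancestor of [x] at depth [j]; the order is read off from the
    pair, since [t] is below [x] exactly when it is the ancestor of [x] at its own
    depth. The values [anc x j] with [j > depth x] are arbitrary. *)
Definition level_ancestors (depth : S -> nat) (anc : S -> nat -> S) : Prop :=
  (forall t x, (t <= x)%O <-> (depth t <= depth x)%N /\ anc x (depth t) = t) /\
  (forall x j, (j <= depth x)%N -> depth (anc x j) = j).

(** The path from the root to [t], continued by a saturated chain from [t] to [x], is
    the only path from the root to [x]. Hence [t <= x] means that the path to
    [t] is a prefix of the path to [x]. *)
Lemma tree_level_ancestors : standard_discrete_poset S ->
  rooted_tree (@covering_graph disp S) ->
  exists depth anc, level_ancestors depth anc.
Proof.
move=> std [e tree].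
have [pth pthP] := choice tree.
have pathP x : path (@covering_graph _ S) e (pth x) by have [[]] := pthP x.
have lastP x : last e (pth x) = x by have [[]] := pthP x.
have uniqP s x : path (@covering_graph _ S) e s -> last e s = x -> s = pth x.
  by move=> ps ls; have [_ uniq_x] := pthP x; exact/esym/uniq_x.
have take_pth x j : take j (pth x) = pth (last e (take j (pth x))).
  by apply: uniqP => //; apply/take_path.
exists (size \o pth), (fun x j => last e (take j (pth x))); split=> [t x|x j jx] /=.
  split=> [tx|[tx <-]].
    have [s [ps ls]] := covering_path_exists std tx.
    have -> : pth x = pth t ++ s.
      by apply/esym/uniqP; rewrite ?cat_path ?last_cat lastP ?pathP.
    by rewrite size_cat leq_addr take_size_cat.
  set y := last e _; rewrite -[leRHS]lastP -(cat_take_drop (size (pth t)) (pth x)).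
  rewrite last_cat; apply: covering_path_le.
  by move: (pathP x); rewrite -{1}(cat_take_drop (size (pth t)) (pth x)) cat_path => /andP[].
by rewrite -take_pth size_takel.
Qed.

End levels.

Section level_ancestors.
Context {disp : Order.disp_t} {S : porderType disp}.
Context (depth : S -> nat) (anc : S -> nat -> S).
Hypothesis lvl : level_ancestors depth anc.

Lemma anc_le x j : (j <= depth x)%N -> (anc x j <= x)%O.
Proof. by have [le_lvl dep_lvl] := lvl; move=> jx; apply/le_lvl; rewrite dep_lvl. Qed.

Lemma anc_depth t x : (t <= x)%O -> anc x (depth t) = t.
Proof. by have [le_lvl _] := lvl; case/le_lvl. Qed.

Lemma depth_le t x : (t <= x)%O -> (depth t <= depth x)%N.
Proof. by have [le_lvl _] := lvl; case/le_lvl. Qed.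

Lemma depth_anc x j : (j <= depth x)%N -> depth (anc x j) = j.
Proof. by have [_] := lvl; apply. Qed.

(** The elements below [z] form a chain, ordered by their depths. *)
Lemma below_chain x y z : (x <= z)%O -> (y <= z)%O -> (depth x <= depth y)%N ->
  (x <= y)%O.
Proof.
move=> xz yz xy; have := anc_le xy.
by rewrite -[X in (X <= y)%O](anc_depth (le_trans (anc_le xy) yz)) depth_anc// anc_depth.
Qed.

End level_ancestors.

(** * Countable partitions and null sets *)

Lemma preimage_bigcup_set1 (T U : Type) (W : T -> U) (D : set U) :
  W @^-1` D = \bigcup_(y in D) (W @^-1` [set y]).
Proof.
apply/seteqP; split=> [w Dw|w [y Dy] /= Wy]; first by exists (W w).
by rewrite /preimage /= Wy.
Qed.

Section countable_partitions.
Context {d : measure_display} {T : measurableType d} {R : realType}.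
Variable P : probability T R.
Local Open Scope ereal_scope.

Lemma ae_eq_probability (E F : set T) : measurable E -> measurable F ->
  {ae P, forall w, E w <-> F w} -> P E = P F.
Proof.
move=> mE mF [N [mN N0 EFN]].
rewrite -(measureU0 mE mN N0) -(measureU0 mF mN N0); congr (P _).
apply/seteqP; split=> w [] Hw; [|by right| |by right].
  have [Nw|nNw] := pselect (N w); [by right|left].
  by have [/(_ Hw)] : E w <-> F w by apply: contrapT => /EFN.
have [Nw|nNw] := pselect (N w); [by right|left].
by have [_ /(_ Hw)] : E w <-> F w by apply: contrapT => /EFN.
Qed.

Lemma probability_fineK (E : set T) : measurable E -> (fine (P E))%:E = P E.
Proof. by move=> mE; rewrite fineK// fin_num_measure. Qed.

Lemma measurable_countable_bigcup (I : Type) (D : set I) (E : I -> set T) :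
  countable [set: I] -> (forall i, D i -> measurable (E i)) ->
  measurable (\bigcup_(i in D) E i).
Proof.
move=> cI mE; rewrite bigcup_mkcond; apply: countable_bigcupT_measurable => // i.
by case: ifP => // /set_mem; exact: mE.
Qed.

(** Numbering the countable index set turns both unions into series, and the
    factor [c] comes out of the series. *)
Lemma proportional_bigcup (I : Type) (D : set I) (E F : I -> set T) (c : R) :
  countable [set: I] ->
  (forall i, D i -> measurable (E i)) -> (forall i, D i -> measurable (F i)) ->
  trivIset D E -> trivIset D F ->
  (forall i, D i -> P (E i) = c%:E * P (F i)) ->
  P (\bigcup_(i in D) E i) = c%:E * P (\bigcup_(i in D) F i).
Proof.
move=> cI mE mF tE tF EF; have /countable_injP[h h_inj] := cI.
pose fiber (G : I -> set T) n := \bigcup_(i in D `&` h @^-1` [set n]) G i.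
have fiber1 G i : D i -> fiber G (h i) = G i.
  move=> Di; apply/seteqP; split=> [w [j [Dj /= hij] Gj]|w Gw]; last by exists i.
  by rewrite -(h_inj _ _ _ _ hij) ?in_setT.
have fiber0 G n : ~ (exists2 i, D i & h i = n) -> fiber G n = set0.
  by move=> nD; rewrite -subset0 => w [i [Di hi] _]; apply: nD; exists i.
have sum_fiber G : (forall i, D i -> measurable (G i)) -> trivIset D G ->
    P (\bigcup_(i in D) G i) = \sum_(n <oo) P (fiber G n).
  move=> mG tG; have mfib n : measurable (fiber G n).
    by apply: measurable_countable_bigcup => // i [Di _]; exact: mG.
  rewrite -measure_semi_bigcup//; last 2 first.
  - move=> m n _ _ [w [[i [Di <-] Gi] [j [Dj <-] Gj]]].
    by congr h; apply: tG => //; exists w.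
  - exact: bigcupT_measurable.
  congr (P _); apply/seteqP; split=> [w [i Di Gi]|w [n _ [i [Di _] Gi]]].
    by exists (h i) => //; rewrite fiber1.
  by exists i.
rewrite !sum_fiber// -nneseriesZl//; apply: eq_eseriesr => n _.
have [[i Di <-]|nD] := pselect (exists2 i, D i & h i = n); first by rewrite !fiber1// EF.
by rewrite !fiber0// measure0 mule0.
Qed.

End countable_partitions.

(** * The past and the future of an independent sequence *)

Section independent_sequences.
Context {d : measure_display} {T : measurableType d} {R : realType}.
Variable P : probability T R.
Context {U : Type} (Z : nat -> T -> U).
Local Open Scope ereal_scope.

Definition path_event (E : set (nat -> U)) : set T := [set w | E (Z ^~ w)].

Definition determined_before (m : nat) (E : set (nat -> U)) : Prop :=
  forall x y, (forall i, (i < m)%N -> x i = y i) -> E x -> E y.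

Hypothesis Z_iid : iid P Z.

(** The product rule for finitely many coordinates is extended to an arbitrary event
    of the first [m] coordinates by induction on [m]: for each value [s] of
    the last coordinate, the slice of the event at [s] depends on fewer coordinates, and
    the condition that this coordinate equals [s] joins the conditions on
    the future. As the values are countably many, the slices can be added up. *)
Lemma past_future_independent (m : nat) (E : set (nat -> U)) :
  countable [set: U] -> determined_before m E ->
  measurable (path_event E) /\
  forall (I : seq nat) (A : nat -> set U), uniq I -> all (leq m) I ->
    P (path_event E `&` \bigcap_(i in [set` I]) (Z i @^-1` A i)) =
    P (path_event E) * \prod_(i <- I) P (Z i @^-1` A i).
Proof.
move=> cU; have [mZ indep _] := Z_iid.
elim: m E => [|m IH] E detE.
  have [[x Ex]|nE] := pselect (exists x, E x).
    have -> : path_event E = setT.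
      by apply/seteqP; split=> // w _; apply: (detE x).
    by split=> // I A uI _; rewrite setTI probability_setT mul1e indep.
  have -> : path_event E = set0.
    by rewrite -subset0 => w Ew; apply: nE; exists (Z ^~ w).
  by split=> // I A _ _; rewrite set0I measure0 mul0e.
(* [slice s]: the event with the coordinate [m] of the sequence frozen at [s]. *)
pose subst s (x : nat -> U) i := if i == m then s else x i.
pose slice s := path_event (subst s @^-1` E).
have IHs s := IH (subst s @^-1` E).
have detEs s : determined_before m (subst s @^-1` E).
  move=> x y xy /=; apply: detE => i; rewrite /subst ltnS leq_eqVlt.
  by case: eqVneq => //= _ /xy.
have mslice s : measurable (slice s) by have [] := IHs s (detEs s).
have mpast s : measurable (slice s `&` Z m @^-1` [set s]).
  by apply: measurableI; [exact: mslice | exact: mZ].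
have EU : path_event E = \bigcup_s (slice s `&` Z m @^-1` [set s]).
  apply/seteqP; split=> [w Ew|w [s _ [Ew /= Zs]]].
    exists (Z m w) => //; split=> //; apply: detE Ew => i _.
    by rewrite /subst; case: eqVneq => // ->.
  by apply: detE Ew => i _; rewrite /subst; case: eqVneq => // ->.
split=> [|I A uI mI].
  by rewrite EU; apply: measurable_countable_bigcup => // s _; exact: mpast.
have mA : measurable (\bigcap_(i in [set` I]) (Z i @^-1` A i)).
  by apply: bigcap_measurableType => i _; exact: mZ.
have -> : \prod_(i <- I) P (Z i @^-1` A i) =
    (\prod_(i <- I) fine (P (Z i @^-1` A i)))%:E.
  by rewrite -prodEFin; apply: eq_bigr => i _; rewrite probability_fineK//; exact: mZ.
rewrite EU setI_bigcupl muleC; apply: proportional_bigcup => //.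
- by move=> s _; exact: measurableI.
- by move=> s t _ _ [w [[[_ <-] _] [[_ <-] _]]].
- by move=> s t _ _ [w [[_ <-] [_ <-]]].
move=> s _; have [_ IHsI] := IHs s (detEs s).
have mnI : m \notin I by apply/negP => /(allP mI); rewrite ltnn.
have leI : all (leq m) I by apply: sub_all mI => i /ltnW.
have setI1 : \bigcap_(i in [set` [:: m]]) (Z i @^-1` [set s]) = Z m @^-1` [set s].
  by rewrite set_cons1 bigcap_set1.
rewrite -setI1 IHsI//=; last by rewrite leqnn.
pose A' i := if i == m then [set s] else A i.
have -> : slice s `&` \bigcap_(i in [set` [:: m]]) (Z i @^-1` [set s])
    `&` \bigcap_(i in [set` I]) (Z i @^-1` A i) =
    slice s `&` \bigcap_(i in [set` m :: I]) (Z i @^-1` A' i).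
  rewrite -setIA setI1; congr (_ `&` _); apply/seteqP; split=> [w [Zs ZI] i /=|w H].
    rewrite inE /A'; case: eqVneq => [-> //|im /=]; exact: ZI.
  split; first by have := H m; rewrite /A' /= inE eqxx; apply.
  move=> i /= iI; have := H i; rewrite /A' /= inE iI orbT.
  by case: eqVneq => [im|_]; [move: mnI; rewrite -im iI | apply].
rewrite IHsI//=; last 2 first.
- by rewrite mnI.
- by rewrite leqnn.
rewrite big_cons big_seq1 /A' eqxx -prodEFin muleA [RHS]muleC; congr (_ * _).
rewrite !big_seq; apply: eq_bigr => i iI; rewrite probability_fineK; last exact: mZ.
by case: eqVneq => // im; move: mnI; rewrite -im iI.
Qed.

(** The probability of missing [A] at [L] successive times is [(1 - a)^L], where [a > 0]
    is the probability of [A]. *)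
Lemma ae_hit (A : set U) : 0 < P (Z 0%N @^-1` A) ->
  {ae P, forall w, forall N, exists2 k, (N <= k)%N & A (Z k w)}.
Proof.
move=> A_gt0; have [mZ indep idZ] := Z_iid.
pose miss N := \bigcap_(k in [set k | (N <= k)%N]) (Z k @^-1` (~` A)).
have mmiss N : measurable (miss N).
  by apply: bigcap_measurableType => i _; exact: mZ.
apply: ae_foralln => N; exists (miss N); split=> //; last first.
  by move=> w /= H k Nk Ak; apply: H; exists k.
pose a := fine (P (Z 0%N @^-1` A)).
have aE : P (Z 0%N @^-1` A) = a%:E by rewrite probability_fineK//; exact: mZ.
have a_gt0 : (0 < a)%R by rewrite -lte_fin -aE.
have a_le1 : (a <= 1)%R by rewrite -lee_fin -aE probability_le1//; exact: mZ.
have miss_le L : P (miss N) <= ((1 - a) ^+ L)%:E.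
  pose missL := \bigcap_(i in [set` iota N L]) (Z i @^-1` (~` A)).
  have -> : ((1 - a) ^+ L)%:E = P missL.
    rewrite indep ?iota_uniq//.
    have -> : \prod_(i <- iota N L) P (Z i @^-1` (~` A)) =
              \prod_(i <- iota N L) (1 - a)%:E.
      apply: eq_bigr => i _; rewrite idZ preimage_setC probability_setC; last exact: mZ.
      by rewrite aE.
    by rewrite prodEFin big_const_seq count_predT size_iota iter_mulr_1.
  apply: le_measure; rewrite ?inE//.
    by apply: bigcap_measurableType => i _; exact: mZ.
  by move=> w H i /=; rewrite mem_iota => /andP[Ni _]; exact: H.
change (P (miss N) = 0); apply/eqP; rewrite eq_le measure_ge0 andbT.
rewrite -(probability_fineK P (mmiss N)) lee_fin.
have lim0 : (GRing.exp (1 - a)%R : R ^nat) @ \oo --> (0 : R)%R.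
  by apply: cvg_expr; rewrite ger0_norm ?subr_ge0// gtrBl.
apply: (cvgr_to_ge lim0); apply: nearW => L.
by rewrite -lee_fin probability_fineK.
Qed.

End independent_sequences.

Section next_hits.
Context {d : measure_display} {T : measurableType d} {R : realType}.
Variable P : probability T R.
Context {U : Type} (Z : nat -> T -> U).
Local Open Scope ereal_scope.
Hypothesis Z_iid : iid P Z.

Definition next_hit (A : set U) (m k : nat) : set (nat -> U) :=
  [set x | [/\ (m <= k)%N, A (x k) & forall j, (m <= j < k)%N -> ~ A (x j)]].

Lemma next_hit_inj A m k l x : next_hit A m k x -> next_hit A m l x -> k = l.
Proof.
move=> [mk Ak mink] [ml Al minl]; case: (ltngtP k l) => // lt.
  by case: (minl k) => //; rewrite mk.
by case: (mink l) => //; rewrite ml.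
Qed.

Lemma exists_next_hit A m x : (exists2 k, (m <= k)%N & A (x k)) ->
  exists k, next_hit A m k x.
Proof.
move=> [k mk Ak].
have exQ : exists k, (m <= k)%N && `[< A (x k) >] by exists k; rewrite mk; exact/asboolP.
case: (ex_minnP exQ) => l /andP[ml /asboolP Al] minl; exists l; split=> // j /andP[mj jl] Aj.
by have := minl j; rewrite mj leqNgt jl => /(_ (asboolT Aj)).
Qed.

(** The first point of [A] from time [m] on has the common law conditioned on [A], and is
    independent of the past. To avoid summing a geometric series,
    [E] is cut according to the time [k] of the hit: in each cell the
    last factor is the probability of [C] on one side and that of [A] on
    the other, and the cells for [A] fill [E] up to a null set. *)
Lemma next_hit_law (m : nat) (E : set (nat -> U)) (A C : set U) :
  countable [set: U] -> determined_before m E ->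
  C `<=` A -> 0 < P (Z 0%N @^-1` A) ->
  P (path_event Z E `&` \bigcup_k path_event Z (next_hit A m k `&` [set x | C (x k)]))
  = (fine (P (Z 0%N @^-1` C)) / fine (P (Z 0%N @^-1` A)))%:E * P (path_event Z E).
Proof.
move=> cU detE CA A_gt0; have [mZ indep idZ] := Z_iid.
set a := fine (P (Z 0%N @^-1` A)); set c := fine (P (Z 0%N @^-1` C)).
have aE n : P (Z n @^-1` A) = a%:E by rewrite idZ probability_fineK//; exact: mZ.
have cE n : P (Z n @^-1` C) = c%:E by rewrite idZ probability_fineK//; exact: mZ.
have a_gt0 : (0 < a)%R by rewrite -lte_fin -(aE 0%N).
(* [miss k]: no hit during the times from [m] to [k - 1]; empty when [k < m]. *)
pose miss k := E `&` [set x | (m <= k)%N /\ forall j, (m <= j < k)%N -> ~ A (x j)].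
have det_miss k : determined_before k (miss k).
  move=> x y xy [Ex [mk missx]]; split.
    by apply: detE Ex => i im; apply: xy; exact: leq_trans mk.
  by split=> // j mjk; rewrite -xy; [exact: missx | case/andP: mjk].
have step k (D : set U) : measurable (path_event Z (miss k) `&` Z k @^-1` D) /\
    P (path_event Z (miss k) `&` Z k @^-1` D) =
    P (path_event Z (miss k)) * P (Z k @^-1` D).
  have [mmiss law] := past_future_independent Z_iid cU (det_miss k).
  split; first by apply: measurableI => //; exact: mZ.
  have := law [:: k] (fun=> D) isT; rewrite /= leqnn => /(_ isT).
  by rewrite set_cons1 bigcap_set1 big_seq1.
have splitE (D : set U) : D `<=` A ->
    path_event Z E `&` \bigcup_k path_event Z (next_hit A m k `&` [set x | D (x k)]) =
    \bigcup_k (path_event Z (miss k) `&` Z k @^-1` D).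
  move=> DA; apply/seteqP; split=> w.
    by move=> [Ew [k _ [[mk Ak missk] Dk]]]; exists k.
  by move=> [k _ [[Ew [mk missk]] Dk]]; split=> //; exists k => //; do 2 split => //; exact: DA.
have triv (D : set U) : D `<=` A ->
    trivIset setT (fun k => path_event Z (miss k) `&` Z k @^-1` D).
  move=> DA k l _ _ [w [[[_ [mk missk]] Dk] [[_ [ml missl]] Dl]]].
  by apply: (@next_hit_inj A m _ _ (Z ^~ w)); split=> //; exact: DA.
have mE : measurable (path_event Z E) by have [] := past_future_independent Z_iid cU detE.
have -> : P (path_event Z E) =
    P (path_event Z E `&` \bigcup_k path_event Z (next_hit A m k `&` [set x | A (x k)])).
  apply: ae_eq_probability => //.
    by rewrite splitE//; apply: bigcupT_measurable => k; have [] := step k A.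
  have := ae_hit Z_iid A_gt0; apply: filterS => w /(_ m) /exists_next_hit [k hitk].
  split=> [Ew|[]//]; split=> //; exists k => //; split=> //.
  by case: hitk.
rewrite !splitE//; apply: proportional_bigcup => //.
- by move=> k _; have [] := step k C.
- by move=> k _; have [] := step k A.
- exact: triv.
- exact: triv.
move=> k _; have [_ ->] := step k A; have [_ ->] := step k C.
rewrite aE cE muleCA -EFinM; congr (_ * _%:E).
by rewrite divfK// gt_eqF.
Qed.

End next_hits.

(** * First indices and ladder times *)

Section first_index.

Lemma first_index_eq (Q : pred nat) k0 k :
  Q k -> (forall j, Q j -> (k <= j)%N) -> first_index Q k0 = k.
Proof.
move=> Qk mink; rewrite /first_index; case: pselect => [exQ|[]]; last by exists k.
case: ex_minnP => l Ql minl; apply/eqP; rewrite eqn_leq minl//=; exact: mink.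
Qed.

Lemma first_index_default (Q : pred nat) k0 :
  (forall j, ~~ Q j) -> first_index Q k0 = k0.
Proof.
move=> nQ; rewrite /first_index; case: pselect => // exQ.
by have [k Qk] := exQ; have := nQ k; rewrite Qk.
Qed.

Lemma first_indexP (Q : pred nat) k0 k :
  first_index Q k0 = k <->
  Q k /\ (forall j, (j < k)%N -> ~~ Q j) \/ k = k0 /\ (forall j, ~~ Q j).
Proof.
split=> [<-|[[Qk mink]|[-> /first_index_default ->//]]]; last first.
  by apply: first_index_eq => // j Qj; rewrite leqNgt; apply/negP => /mink; rewrite Qj.
rewrite /first_index; case: pselect => [exQ|nQ].
  left; case: ex_minnP => l Ql minl; split=> // j jl; apply/negP => /minl.
  by rewrite leqNgt jl.
by right; split=> // j; apply/negP => Qj; apply: nQ; exists j.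
Qed.

Lemma measurable_first_index {d : measure_display} {T : measurableType d}
    (Q : nat -> T -> bool) (k0 k : nat) :
  (forall j, measurable [set w | Q j w]) ->
  measurable [set w | first_index (Q ^~ w) k0 = k].
Proof.
move=> mQ.
have mnQ j : measurable [set w | ~~ Q j w].
  rewrite (_ : [set w | _] = ~` [set w | Q j w]); first exact: measurableC.
  by apply/seteqP; split=> w /=; [move/negP|move=> /negP].
rewrite (_ : [set w | _] =
    [set w | Q k w] `&` \bigcap_(j in [set j | (j < k)%N]) [set w | ~~ Q j w] `|`
    (if k == k0 then \bigcap_j [set w | ~~ Q j w] else set0)).
  apply: measurableU; last by case: ifP => // _; exact: bigcapT_measurable.
  by apply: measurableI => //; apply: bigcap_measurableType => j _.
apply/seteqP; split=> w /=.
  move=> /first_indexP[[Qk mink]|[-> nQ]]; first by left.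
  by right; rewrite eqxx => j _; exact: nQ.
move=> H; apply/first_indexP; case: H => [[Qk mink]|]; first by left.
by case: eqVneq => // -> nQ; right; split=> // j; exact: nQ.
Qed.

End first_index.

Section ladder_paths.
Context {disp : Order.disp_t} {S : porderType disp}.
Implicit Type x : nat -> S.

(** [ladder_at n m] says that the [n]-th ladder time is genuinely [m]. Unlike
    the equation [ladder_time x n = m], which also holds by default when no later point
    dominates, it depends only on the first [m + 1] terms of the sequence. *)
Fixpoint ladder_at (n m : nat) : set (nat -> S) :=
  if n is n'.+1 then
    [set x | exists2 l, ladder_at n' l x &
      next_hit [set u | (x l <= u)%O] l.+1 m x]
  else [set x | m = 0%N].

Lemma ladder_at_determined n m : determined_before m.+1 (ladder_at n m).
Proof.
elim: n m => [m x y _ -> //|n IH] m x y xy /= [l ladl [lm xlm missx]].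
have xyl : x l = y l by apply: xy; exact: ltnW.
exists l; first by apply: IH ladl => i il; apply: xy; exact: leqW (leq_trans il lm).
split=> //=; first by rewrite -xyl -xy.
move=> j /andP[lj jm]; rewrite -xyl -xy; last exact: ltnW.
by apply: missx; rewrite lj.
Qed.

Lemma ladder_at_time n m x : ladder_at n m x -> ladder_time x n = m.
Proof.
elim: n m x => [m x /= ->//|n IH] m x /= [l /IH -> [lm xlm missx]].
apply: first_index_eq => [|j /andP[lj xlj]]; first by rewrite lm xlm.
by rewrite leqNgt; apply/negP => jm; apply: (missx j) => //; rewrite lj.
Qed.

Lemma ladder_time_at n x :
  (forall (t : S) N, exists2 k, (N <= k)%N & (t <= x k)%O) ->
  ladder_at n (ladder_time x n) x.
Proof.
move=> hits; elim: n => [//|n IH].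
have [k hitk] := exists_next_hit (hits (x (ladder_time x n)) (ladder_time x n).+1).
by have atk : ladder_at n.+1 k x; [exists (ladder_time x n)|rewrite (ladder_at_time atk)].
Qed.

Lemma ladder_le n x : (ladder x n <= ladder x n.+1)%O.
Proof.
rewrite /ladder /=; set N := ladder_time x n.
have /first_indexP := erefl (first_index (fun k => (N < k)%N && (x N <= x k)%O) N).
by case=> [[/andP[_ ?] _]//|[-> _]].
Qed.

End ladder_paths.

(** * The ladder points form a Markov chain *)

Section ladder_law.
Context {disp : Order.disp_t} {S : porderType disp}.
Context {d : measure_display} {T : measurableType d} {R : realType}.
Variable P : probability T R.
Variable X : nat -> T -> S.
Hypothesis countS : countable [set: S].
Hypothesis X_iid : iid P X.
Hypothesis upper_gt0 : forall t : S, (0 < upper_probability P (X 0%N) t)%E.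
Local Open Scope ereal_scope.

Lemma measurable_ladder_time n m :
  measurable [set w | ladder_time (X ^~ w) n = m].
Proof.
have [mX _ _] := X_iid; elim: n m => [|n IH] m.
  have [->|m0] := eqVneq m 0%N.
    by rewrite (_ : [set w | _] = setT)//; apply/seteqP.
  rewrite (_ : [set w | _] = set0)//; apply/seteqP; split=> // w /= m0'.
  by rewrite -m0' eqxx in m0.
rewrite (_ : [set w | _] = \bigcup_l ([set w | ladder_time (X ^~ w) n = l] `&`
   [set w | first_index (fun k => (l < k)%N && (X l w <= X k w)%O) l = m])).
  apply: bigcupT_measurable => l; apply: measurableI; first exact: IH.
  pose Q k w := (l < k)%N && (X l w <= X k w)%O.
  apply: (@measurable_first_index _ _ Q) => k; rewrite /Q.
  case: (ltnP l k) => lk /=; last first.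
    by rewrite (_ : [set w | _] = set0)//; apply/seteqP; split=> w.

  rewrite (_ : [set w | _] =
      \bigcup_t (X l @^-1` [set t] `&` X k @^-1` [set u | (t <= u)%O])).
    by apply: measurable_countable_bigcup => // t _; apply: measurableI; exact: mX.
  by apply/seteqP; split=> [w /= le_lk|w [t _ [/= -> ?]]//]; exists (X l w).
apply/seteqP; split=> [w /= <-|w [l _ /= [-> ->]]//].
by exists (ladder_time (X ^~ w) n).
Qed.

Lemma discrete_rv_ladder n : discrete_rv (fun w => ladder (X ^~ w) n).
Proof.
have [mX _ _] := X_iid; move=> A.
rewrite (_ : _ @^-1` _ = \bigcup_m ([set w | ladder_time (X ^~ w) n = m] `&` X m @^-1` A)).
  apply: bigcupT_measurable => m; apply: measurableI; last exact: mX.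
  exact: measurable_ladder_time.
apply/seteqP; split=> w; first by exists (ladder_time (X ^~ w) n).
by move=> [m _ [/= Nm Am]]; rewrite /ladder Nm.
Qed.

(** On the event that the [n]-th ladder time is [m] and that the point there is [t], which
    depends on the times up to [m], the next ladder point is the first
    later point above [t], so [next_hit_law] applies; then the events for
    all [m] are put together. *)
Lemma ladder_transition n (t x : S) : (t <= x)%O ->
  P ([set w | ladder (X ^~ w) n = t] `&` [set w | ladder (X ^~ w) n.+1 = x]) =
  (fine (P (X 0%N @^-1` [set x])) / fine (upper_probability P (X 0%N) t))%:E *
  P [set w | ladder (X ^~ w) n = t].
Proof.
move=> tx; have [mX _ _] := X_iid.
pose past m := ladder_at n m `&` [set y : nat -> S | y m = t].
have det_past m : determined_before m.+1 (past m).
  move=> y z yz [aty yt]; split; first exact: ladder_at_determined aty.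
  by rewrite /= -yz.
pose next m := \bigcup_k path_event X
  (next_hit [set u | (t <= u)%O] m.+1 k `&` [set y | [set x] (y k)]).
have mpast m : measurable (path_event X (past m)).
  by have [] := past_future_independent X_iid countS (@det_past m).
have mnext m : measurable (next m).
  apply: bigcupT_measurable => k.
  have det_k : determined_before k.+1
     (next_hit [set u | (t <= u)%O] m.+1 k `&` [set y : nat -> S | [set x] (y k)]).
    move=> y z yz [[mk hitk missk] xk]; split; last by rewrite /= -yz.
    split=> //; first by rewrite /= -yz.
    move=> j mjk; rewrite /= -yz; first exact: missk.
    by case/andP: mjk => _ /ltnW.
  by have [] := past_future_independent X_iid countS det_k.
have law m := next_hit_law X_iid countS (@det_past m)
  (_ : [set x] `<=` [set u | (t <= u)%O]) (upper_gt0 t).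
have past_inj m m' w : past m (X ^~ w) -> past m' (X ^~ w) -> m = m'.
  by move=> [/ladder_at_time <- _] [/ladder_at_time <- _].
(* Every element is dominated infinitely often, so that outside a null set no default
   value enters the ladder times. *)
have hits : {ae P, forall w, forall u N, exists2 k, (N <= k)%N & (u <= X k w)%O}.
  have /countable_injP[h h_inj] := countS.
  have : {ae P, forall w, forall i u, h u = i ->
      forall N, exists2 k, (N <= k)%N & (u <= X k w)%O}.
    apply: ae_foralln => i; have [[u hu]|nu] := pselect (exists u, h u = i).
      have := @ae_hit _ _ _ _ _ _ X_iid [set v | (u <= v)%O] (upper_gt0 u).
      apply: filterS => w hitu v hv.
      by rewrite (h_inj v u) ?in_setT// hv.
    by apply: aeW => w u hu; case: nu; exists u.
  by apply: filterS => w H u; exact: (H (h u)).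
have mlad k u : measurable [set w | ladder (X ^~ w) k = u].
  exact: (discrete_rv_ladder k [set u]).
have -> : P [set w | ladder (X ^~ w) n = t] = P (\bigcup_m path_event X (past m)).
  apply: ae_eq_probability => //; first exact: bigcupT_measurable.
  apply: filterS hits => w hits; split=> [Yt|[m _ [/ladder_at_time Nm /= Xt]]].
    by exists (ladder_time (X ^~ w) n) => //; split=> //; exact: ladder_time_at.
  by rewrite /ladder /= Nm.
have -> : P ([set w | ladder (X ^~ w) n = t] `&` [set w | ladder (X ^~ w) n.+1 = x]) =
    P (\bigcup_m (path_event X (past m) `&` next m)).
  apply: ae_eq_probability; first exact: measurableI.
    by apply: bigcupT_measurable => m; exact: measurableI.
  apply: filterS hits => w hits; split=> [[Yt Yx]|].
    have [m atm hitm] := @ladder_time_at _ _ n.+1 (X ^~ w) hits.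
    have Nm := ladder_at_time atm; have Xmt : X m w = t by rewrite -Yt /ladder Nm.
    exists m => //; split=> //; exists (ladder_time (X ^~ w) n.+1) => //.
    by split=> //; move: hitm; rewrite Xmt.
  move=> [m _ [[atm Xmt] [k _ [hitk Xkx]]]].
  have atk : ladder_at n.+1 k (X ^~ w) by exists m => //; rewrite Xmt.
  by split; rewrite /= /ladder ?(ladder_at_time atm) ?(ladder_at_time atk).
apply: proportional_bigcup => //.
- by move=> m _; exact: measurableI.
- by move=> m m' _ _ [w [[pastm _] [pastm' _]]]; exact: past_inj pastm pastm'.
- by move=> m m' _ _ [w [pastm pastm']]; exact: past_inj pastm pastm'.
by move=> m _; apply: law => u ->.
Qed.

End ladder_law.

(** * Thinning by independent trials *)

Section thinning.
Context {disp : Order.disp_t} {S : porderType disp}.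
Context {d : measure_display} {T : measurableType d} {R : realType}.
Variable P : probability T R.
Variables (Y : nat -> T -> S) (B : nat -> T -> bool) (p : R).
Hypothesis mY : forall n, discrete_rv (Y n).
Hypothesis B_iid : iid P B.
Hypothesis p_gt0 : 0 < p.
Hypothesis B_accept : P (B 0%N @^-1` [set true]) = p%:E.
Hypothesis B_indep_Y : independent_processes P B Y.
Local Open Scope ereal_scope.

Let accepted n := path_event B (next_hit [set true] 0 n).
Let trial (n j : nat) : set bool := if j == n then [set true] else [set false].

Lemma first_acceptE n :
  accepted n = \bigcap_(j in [set` iota 0 n.+1]) (B j @^-1` trial n j).
Proof.
have in_iota j : [set` iota 0 n.+1] j = (j <= n)%N :> Prop.
  by rewrite -[LHS]/(is_true (j \in iota 0 n.+1)) mem_iota.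
apply/seteqP; split=> [w [_ Bn missn] j|w H].
  rewrite in_iota /trial leq_eqVlt; case: eqVneq => [->//|_ /= jn].
  by apply/negP => Bj; apply: (missn j).
split=> //=; first by have := H n; rewrite in_iota /trial eqxx; apply.
move=> j jn; have := H j; rewrite in_iota /trial (ltnW jn) (ltn_eqF jn).
by move=> /(_ isT) ->.
Qed.

Lemma first_accept_law n : P (accepted n) = (p * (1 - p) ^+ n)%:E.
Proof.
have [mB indep idB] := B_iid.
have reject j : P (B j @^-1` [set false]) = (1 - p)%:E.
  rewrite idB (_ : _ @^-1` _ = ~` (B 0%N @^-1` [set true])).
    by rewrite probability_setC ?B_accept//; exact: mB.
  by apply/seteqP; split=> w /=; case: (B 0%N w).
rewrite first_acceptE indep ?iota_uniq// -addn1 iotaD big_cat big_seq1 add0n.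
rewrite /trial eqxx idB B_accept (_ : \prod_(_ <- _) _ = \prod_(i <- iota 0 n) (1 - p)%:E).
  by rewrite prodEFin big_const_seq count_predT size_iota iter_mulr_1 mulrC.
by apply: eq_big_seq => j; rewrite mem_iota add0n => /andP[_ jn]; rewrite ltn_eqF// reject.
Qed.

Lemma discrete_rv_first_accepted :
  discrete_rv (fun w => first_accepted (B ^~ w) (Y ^~ w)).
Proof.
have [mB _ _] := B_iid; move=> A.
rewrite (_ : _ @^-1` _ =
    \bigcup_n ([set w | first_index (B ^~ w) 0 = n] `&` Y n @^-1` A)).
  apply: bigcupT_measurable => n; apply: measurableI; last exact: mY.
  apply: measurable_first_index => j; exact: (mB j [set true]).
apply/seteqP; split=> w; first by exists (first_index (B ^~ w) 0).
by move=> [n _ [/= Nn An]]; rewrite /first_accepted Nn.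
Qed.

(** The event that the trial [n] is the first success belongs to the sigma-algebra of the
    trials, hence is independent of [Y n]; some trial succeeds almost surely. *)
Lemma first_accepted_law (x : S) :
  P [set w | first_accepted (B ^~ w) (Y ^~ w) = x] =
  \sum_(n <oo) (p * (1 - p) ^+ n)%:E * P (Y n @^-1` [set x]).
Proof.
have [mB _ _] := B_iid.
have mG j (A : set bool) : process_sigma_algebra B (B j @^-1` A).
  by apply: sub_sigma_algebra; exists j, A.
have sigma_accepted n : process_sigma_algebra B (accepted n).
  rewrite first_acceptE.
  apply: (@bigcap_measurableType _ (g_sigma_algebraType
    [set E | exists n (A : set bool), E = B n @^-1` A])) => j _; exact: mG.
have macc n : measurable (accepted n).
  by rewrite first_acceptE; apply: bigcap_measurableType => j _; exact: mB.
have macY n : measurable (accepted n `&` Y n @^-1` [set x]).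
  by apply: measurableI => //; exact: mY.
transitivity (P (\bigcup_n (accepted n `&` Y n @^-1` [set x]))).
  apply: ae_eq_probability; first exact: (discrete_rv_first_accepted [set x]).
    exact: bigcupT_measurable.
  have acc_gt0 : 0 < P (B 0%N @^-1` [set true]) by rewrite B_accept lte_fin.
  have := ae_hit B_iid acc_gt0; apply: filterS => w /(_ 0%N) /exists_next_hit [k hitk].
  have firstE n : next_hit [set true] 0 n (B ^~ w) -> first_index (B ^~ w) 0 = n.
    move=> [_ /= Bn missn]; apply: first_index_eq; first by rewrite Bn.
    by move=> j Bj; rewrite leqNgt; apply/negP => jn; apply: (missn j).
  split=> [Zx|[n _ [/firstE accn Yn]]]; last by rewrite /= /first_accepted accn.
  by exists k => //; split=> //; move: Zx; rewrite /= /first_accepted (firstE k).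
rewrite measure_semi_bigcup//; last 2 first.
- by move=> k l _ _ [w [[acck _] [accl _]]]; exact: next_hit_inj acck accl.
- exact: bigcupT_measurable.
apply: eq_eseriesr => n _; rewrite -first_accept_law; apply: B_indep_Y => //.
by apply: sub_sigma_algebra; exists n, [set x].
Qed.

End thinning.

(** * The law of the first accepted point *)

Section first_accepted_point.
Context {disp : Order.disp_t} {S : porderType disp}.
Context {d : measure_display} {T : measurableType d} {R : realType}.
Variable P : probability T R.
Variables (X : nat -> T -> S) (B : nat -> T -> bool) (alpha p : R).
Variables (depth : S -> nat) (anc : S -> nat -> S).
Hypothesis lvl : level_ancestors depth anc.
Hypothesis countS : countable [set: S].
Hypothesis X_iid : iid P X.
Hypothesis X_rate : has_constant_rate P (X 0%N) alpha.
Hypothesis p_range : (0 < p < 1)%R.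
Hypothesis B_iid : iid P B.
Hypothesis B_accept : P (B 0%N @^-1` [set true]) = p%:E.
Hypothesis B_indep_Y : independent_processes P B (fun n w => ladder (X ^~ w) n).
Local Open Scope ereal_scope.

Let Y n w := ladder (X ^~ w) n.
Let Z w := first_accepted (B ^~ w) (ladder (X ^~ w)).
Let f x := fine (P (X 0%N @^-1` [set x])).
Let F x := fine (upper_probability P (X 0%N) x).
Let g x := fine (P (Z @^-1` [set x])).
Let q := (1 - alpha + p * alpha)%R.

Let mX n : discrete_rv (X n). Proof. by have [] := X_iid. Qed.

Let p_gt0 : (0 < p)%R. Proof. by case/andP: p_range. Qed.

Let p_lt1 : (p < 1)%R. Proof. by case/andP: p_range. Qed.

Let mY n : discrete_rv (Y n). Proof. exact: (discrete_rv_ladder countS X_iid n). Qed.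

Let mZ : discrete_rv Z.
Proof. exact: (discrete_rv_first_accepted mY B_iid). Qed.

Let fE x : P (X 0%N @^-1` [set x]) = (f x)%:E.
Proof. by rewrite probability_fineK//; exact: mX. Qed.

Let FE x : upper_probability P (X 0%N) x = (F x)%:E.
Proof. by rewrite probability_fineK//; exact: (mX 0%N [set u | (x <= u)%O]). Qed.

Let gE x : P (Z @^-1` [set x]) = (g x)%:E.
Proof. by rewrite probability_fineK//; exact: mZ. Qed.

Let f_gt0 x : (0 < f x)%R.
Proof. by have [_ pos _ _] := X_rate; rewrite -lte_fin -fE. Qed.

Let fF x : f x = (alpha * F x)%R.
Proof. by have [_ _ _ rate] := X_rate; apply: EFin_inj; rewrite -fE rate FE. Qed.

Let alpha_gt0 : (0 < alpha)%R. Proof. by have [] := X_rate. Qed.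

Let F_gt0 x : (0 < F x)%R.
Proof. by have := f_gt0 x; rewrite fF pmulr_rgt0. Qed.

Let upper_gt0 x : 0 < upper_probability P (X 0%N) x.
Proof. by rewrite FE lte_fin. Qed.

Lemma rate_le1 (x : S) : (alpha <= 1)%R.
Proof.
have : (f x <= F x)%R.
  rewrite -lee_fin -fE -FE; apply: le_measure; rewrite ?inE.
  - exact: mX.
  - exact: (mX 0%N [set u | (x <= u)%O]).
  - by move=> w /= ->.
by rewrite fF ger_pMl.
Qed.

Let q_gt0 (x : S) : (0 < q)%R.
Proof. by rewrite ltr_wpDl ?subr_ge0 ?(rate_le1 x)// mulr_gt0. Qed.

(** The previous ladder point is below [x], hence one of the ancestors of [x]. *)
Lemma ladder_law_rec n x :
  P (Y n.+1 @^-1` [set x]) =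
  \sum_(j < (depth x).+1) (f x / F (anc x j))%:E * P (Y n @^-1` [set anc x j]).
Proof.
have anc_x (j : 'I_(depth x).+1) : (anc x j <= x)%O.
  by apply: (anc_le lvl); rewrite -ltnS.
under eq_bigr => j _ do
  rewrite -(ladder_transition countS X_iid upper_gt0 n (anc_x j)).
rewrite -measure_bigsetU_ord//; last 2 first.
- by move=> j; apply: measurableI; [exact: (mY n [set _])|exact: (mY n.+1 [set _])].
- move=> i j _ _ [w [[/= Yi _] [/= Yj _]]]; apply: ord_inj.
  have di (k : 'I_(depth x).+1) : depth (anc x k) = k.
    by apply: (depth_anc lvl); rewrite -ltnS.
  by rewrite -di -[RHS]di -Yi -Yj.
congr (P _); apply/seteqP; split=> w.
  move=> Yx; have Yn_x : (Y n w <= x)%O by rewrite -Yx; exact: ladder_le.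
  have dY : (depth (Y n w) < (depth x).+1)%N by rewrite ltnS (depth_le lvl).
  rewrite -bigcup_seq; exists (Ordinal dY); [exact: mem_index_enum |split=> //=].
  by rewrite (anc_depth lvl).
by rewrite -bigcup_seq => -[j _ []].
Qed.

(** The term [n = 0] of the law of [Z] is [p f x]; in the term [n + 1] one factor [1 - p] is
    set apart and the ladder chain is taken one step back. *)
Lemma first_accepted_rec x :
  g x = (p * f x + (1 - p) * \sum_(j < (depth x).+1) f x / F (anc x j) * g (anc x j))%R.
Proof.
have law t : (g t)%:E = \sum_(n <oo) (p * (1 - p) ^+ n)%:E * P (Y n @^-1` [set t]).
  by rewrite -gE; exact: (first_accepted_law mY B_iid p_gt0 B_accept B_indep_Y).
have pn_ge0 n : (0 <= p * (1 - p) ^+ n)%R.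
  by rewrite mulr_ge0 ?exprn_ge0 ?subr_ge0 ?ltW.
have term_ge0 t n : 0 <= (p * (1 - p) ^+ n)%:E * P (Y n @^-1` [set t]).
  by rewrite mule_ge0 ?lee_fin.
have c_ge0 (j : nat) : (0 <= (1 - p) * (f x / F (anc x j)))%R.
  by rewrite mulr_ge0 ?subr_ge0 ?divr_ge0 ?ltW.
apply: EFin_inj; rewrite law nneseries_recl// -nneseries_addn//.
rewrite expr0 mulr1 fE EFinD -EFinM; congr (_ + _).
rewrite mulr_sumr -sumEFin.
transitivity (\sum_(n <oo) \sum_(j < (depth x).+1)
    ((1 - p) * (f x / F (anc x j)))%:E *
    ((p * (1 - p) ^+ n)%:E * P (Y n @^-1` [set anc x j]))).
  apply: eq_eseriesr => n _; rewrite addn1 ladder_law_rec ge0_sume_distrr; last first.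
    by move=> j _; rewrite mule_ge0// lee_fin divr_ge0 ?ltW.
  apply: eq_bigr => j _; rewrite !muleA -!EFinM; congr (_%:E * _).
  by rewrite exprS; ring.
rewrite nneseries_sum; last by move=> j n _; rewrite mule_ge0 ?lee_fin.
apply: eq_bigr => j _; rewrite nneseriesZl; last by move=> n _.
by rewrite -law -EFinM !mulrA.
Qed.

Lemma geometric_closed_form (r : R) n : (r != 0)%R ->
  (1 + (1 - r) * \sum_(j < n) r^-1 ^+ j.+1 = r^-1 ^+ n)%R.
Proof.
move=> r0; elim: n => [|n IH]; first by rewrite big_ord0 mulr0 addr0.
by rewrite big_ord_recr /= mulrDr addrA IH exprS; field.
Qed.

(** The term of the renewal equation at [x] itself is [(1 - p) alpha g x]; moved
    to the left, it gives [q g x], since [q = 1 - (1 - p) alpha]. The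
    other terms are known by induction and add up to a geometric sum. *)
Lemma first_accepted_pmf x : g x = (p / q ^+ (depth x).+1 * f x)%R.
Proof.
move: {2}(depth x).+1 (ltnSn (depth x)) => N; elim: N x => [//|N IH] x.
rewrite ltnS => dN; have q0 : (q != 0)%R by rewrite gt_eqF ?(q_gt0 x).
have F0 y : (F y != 0)%R by rewrite gt_eqF.
have alpha0 : (alpha != 0)%R by rewrite gt_eqF.
have := first_accepted_rec x; rewrite big_ord_recr /= (anc_depth lvl)//.
have -> : (f x / F x = alpha)%R by rewrite fF mulfK.
have -> : (\sum_(j < depth x) f x / F (anc x j) * g (anc x j) =
    f x * alpha * p * \sum_(j < depth x) q^-1 ^+ j.+1)%R.
  rewrite mulr_sumr; apply: eq_bigr => j _.
  have dj : depth (anc x j) = j by apply: (depth_anc lvl); exact: ltnW.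
  rewrite IH dj; last exact: leq_trans (ltn_ord j) dN.
  by rewrite (fF (anc x j)) exprVn; field; rewrite F0 expf_neq0.
move=> rec; have closed := geometric_closed_form (depth x) q0.
apply: (mulfI q0).
have -> : (q * (p / q ^+ (depth x).+1 * f x) = p * f x * q^-1 ^+ depth x)%R.
  by rewrite exprVn exprS; field; rewrite q0 expf_neq0.
rewrite -closed.
have -> : (q * g x = g x - (1 - p) * alpha * g x)%R by rewrite /q; ring.
by rewrite {1}rec /q; ring.
Qed.

Let level x j : set S := [set y | (x <= y)%O /\ depth y = (depth x + j)%N].

(** [X_0] lies above [x] at relative depth at least [k] exactly when it lies above one of
    the elements of [level x k], and that element is then unique. So the
    constant rate makes the mass of [level x k] equal to [alpha] times the mass
    at relative depth at least [k], which is left with a factor [1 - alpha] at each step. *)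
Lemma rate_level x j :
  P (X 0%N @^-1` level x j) = (alpha * (1 - alpha) ^+ j * F x)%:E.
Proof.
pose above k : set S := [set z | (x <= z)%O /\ (depth x + k <= depth z)%N].
have mA k : measurable (X 0%N @^-1` above k) by exact: mX.
have levelE k : P (X 0%N @^-1` level x k) = alpha%:E * P (X 0%N @^-1` above k).
  rewrite (preimage_bigcup_set1 (X 0%N) (level x k)).
  have -> : X 0%N @^-1` above k =
      \bigcup_(y in level x k) (X 0%N @^-1` [set z | (y <= z)%O]).
    apply/seteqP; split=> [w [xz dz]|w [y [xy dy] /= yz]].
      have yz := anc_le lvl dz; exists (anc (X 0%N w) (depth x + k)) => //.
      split; last exact: (depth_anc lvl).
      by apply: (below_chain lvl xz yz); rewrite (depth_anc lvl)// leq_addr.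
    by split; [exact: le_trans yz | rewrite -dy (depth_le lvl)].
  apply: proportional_bigcup => //.
  - by move=> y _; exact: mX.
  - by move=> y _; exact: (mX 0%N [set z | (y <= z)%O]).
  - by move=> y y' _ _ [w [/= <- <-]].
  - move=> y y' [_ dy] [_ dy'] [w [/= yz yz']].
    by rewrite -(anc_depth lvl yz) -(anc_depth lvl yz') dy dy'.
  by move=> y _; rewrite fE fF EFinM -FE.
have aboveS k : P (X 0%N @^-1` above k) =
    P (X 0%N @^-1` level x k) + P (X 0%N @^-1` above k.+1).
  rewrite -measureU//; last 2 first.
  - exact: mX.
  - rewrite -subset0 => w [[_ dw] [_]]; rewrite dw addnS ltnn.
    by [].
  congr (P _); apply/seteqP; split=> [w [xw]|w [[xw dw]|[xw dw]]].
  - rewrite leq_eqVlt => /orP[/eqP dw|dw]; first by left.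
    by right; split=> //; rewrite addnS.
  - by split=> //; rewrite dw.
  - by split=> //; rewrite ltnW// -addnS.
have aboveE k : P (X 0%N @^-1` above k) = ((1 - alpha) ^+ k * F x)%:E.
  elim: k => [|k IH].
    rewrite expr0 mul1r -FE; congr (P _); apply/seteqP; split=> w /= => [[]//|xw].
    by split=> //; rewrite addn0 (depth_le lvl).
  have := aboveS k; rewrite levelE IH -(probability_fineK P (mA k.+1)) -EFinM -EFinD.
  move=> [rec]; congr EFin; rewrite exprS.
  by apply: (addrI (alpha * ((1 - alpha) ^+ k * F x))%R); rewrite -rec; ring.
by rewrite levelE aboveE -EFinM mulrA.
Qed.

Let r := (p * alpha / q)%R.

(** [g / f] is constant on a level and is divided by [q] from one level to the next, while the mass
    of [X_0] is multiplied by [1 - alpha]; and [(1 - alpha) / q = 1 - r]. *)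
Lemma first_accepted_level x j : P (Z @^-1` level x j) = (g x * (1 - r) ^+ j)%:E.
Proof.
have q0 : (q != 0)%R by rewrite gt_eqF ?(q_gt0 x).
transitivity ((p / q ^+ (depth x + j).+1)%:E * P (X 0%N @^-1` level x j)).
  rewrite (preimage_bigcup_set1 Z) (preimage_bigcup_set1 (X 0%N)).
  apply: proportional_bigcup => //.
  - by move=> y _; exact: mX.
  - by move=> y y' _ _ [w [/= <- <-]].
  - by move=> y y' _ _ [w [/= <- <-]].
  by move=> y [_ dy]; rewrite gE fE -EFinM first_accepted_pmf dy.
rewrite rate_level -EFinM first_accepted_pmf fF; congr EFin.
have -> : (1 - r = (1 - alpha) / q)%R by rewrite /r /q; field.
by rewrite expr_div_n exprS exprD exprS; field; rewrite q0 !expf_neq0.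
Qed.

Lemma first_accepted_upper x : upper_probability P Z x = (g x / r)%:E.
Proof.
have q0 := q_gt0 x; have r_gt0 : (0 < r)%R by rewrite divr_gt0 ?mulr_gt0.
have r_le1 : (r <= 1)%R.
  by rewrite ler_pdivrMr// mul1r /q lerDr subr_ge0 (rate_le1 x).
have -> : upper_probability P Z x = P (\bigcup_j (Z @^-1` level x j)).
  congr (P _); apply/seteqP; split=> [w /= xw|w [j _ []]//].
  by exists (depth (Z w) - depth x)%N => //; split=> //; rewrite subnKC// (depth_le lvl).
rewrite measure_semi_bigcup; last 3 first.
- by move=> j; exact: (mZ (level x j)).
- move=> i j _ _ [w [[_ di] [_ dj]]].
  by apply/eqP; rewrite -(eqn_add2l (depth x)) -di -dj.
- by apply: bigcupT_measurable => j; exact: (mZ (level x j)).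
transitivity (\sum_(j <oo) (g x * (1 - r) ^+ j)%:E).
  by apply: eq_eseriesr => j _; exact: first_accepted_level.
apply: cvg_lim => //.
rewrite (_ : (fun n => _) = EFin \o series (geometric (g x) (1 - r)%R)); last first.
  by apply/funext => n /=; rewrite sumEFin.
have -> : (g x / r = g x * (1 - (1 - r))^-1)%R by congr (_ * _^-1)%R; ring.
apply: cvg_EFin; first exact: nearW.
by apply: cvg_geometric_series; rewrite ger0_norm ?subr_ge0// gtrBl.
Qed.

Lemma first_accepted_constant_rate (x0 : S) : has_constant_rate P Z r.
Proof.
have r_gt0 : (0 < r)%R by rewrite divr_gt0 ?mulr_gt0 ?(q_gt0 x0).
split=> // x.
  by rewrite gE lte_fin first_accepted_pmf mulr_gt0 ?divr_gt0 ?exprn_gt0 ?(q_gt0 x).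
by rewrite gE first_accepted_upper -EFinM mulrCA divff ?mulr1 ?gt_eqF.
Qed.

End first_accepted_point.

Theorem proposition14 (disp : Order.disp_t) (S : porderType disp)
    (S_standard : standard_discrete_poset S)
    (S_tree : rooted_tree (@covering_graph disp S))
    (S_no_leaf : forall x : S, ~ leaf x)
    (R : realType) (d : measure_display) (T : measurableType d)
    (P : probability T R)
    (X : nat -> T -> S) (alpha : R)
    (X_iid : iid P X)
    (X_rate : has_constant_rate P (X 0%N) alpha)
    (p : R) (p_range : 0 < p < 1)
    (B : nat -> T -> bool)
    (B_iid : iid P B)
    (B_accept : P (B 0%N @^-1` [set true]) = p%:E)
    (B_indep_Y : independent_processes P B (fun n w => ladder (X ^~ w) n)) :
  has_constant_rate P
    (fun w => first_accepted (B ^~ w) (ladder (X ^~ w)))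
    (p * alpha / (1 - alpha + p * alpha)).
Proof.
have [countS _] := S_standard; have [e _] := S_tree.
have [depth [anc lvl]] := tree_level_ancestors S_standard S_tree.
exact: (first_accepted_constant_rate lvl countS X_iid X_rate p_range B_iid
  B_accept B_indep_Y e).
Qed.
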